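(* The nearly finite Chacon transformation $(X,\mathcal B(X),\mu,T)$ is rationally ergodic, and hence admits a measurable law of large numbers.
   Context: **The nearly finite Chacon transformation.** Let $\mathbb N=\{0,1,2,\dots\}$. Fix strictly increasing integer sequences $(\ell_k)_{k\ge0}$ and $(n_\ell)_{\ell\ge1}$ with $\ell_0=1$, $n_1>1$, $(1+7^{-k})^{\ell_{k+1}-\ell_k}\ge 2$ for all $k\ge0$, and $n_\ell>n_{\ell-1}+2\ell$ for all $\ell\ge2$. For $\ell\ge1$, $k(\ell)$ is the unique $k\ge0$ with $\ell_k\le\ell<\ell_{k+1}$. Set $h_0=1$ and, for $n\ge0$, $h_{n+1}=3h_n+3a_n+1$, where $a_n=h_{n_\ell-k(\ell)}$ if $n=n_\ell$ for some $\ell$, and $a_n=0$ if $n\notin\{n_\ell:\ell\ge1\}$. Put $b_n^1=0$, $b_n^2=h_n+a_n$, $b_n^3=2h_n+2a_n+1$. Define $p_n:\{0,\dots,h_{n+1}-1\}\cup\{\ast\}\to\{0,\dots,h_n-1\}\cup\{\ast\}$ by $p_n(b_n^t+i)=i$ for $t\in\{1,2,3\}$, $0\le i<h_n$, and $p_n=\ast$ at all other points (including $p_n(\ast)=\ast$). Let $X=\{(j_n)_{n\ge0}:\ j_n\in\{0,\dots,h_n-1\}\cup\{\ast\},\ j_n=p_n(j_{n+1})\ \forall n,\ \text{and } j_{n}\ne\ast\text{ for some }n\}$, with the topology induced by the product of discrete topologies. For $x\in X$, $j_n(x)$ is its $n$-th coordinate; $L_n^j=\{x\in X: j_n(x)=j\}$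 for $0\le j<h_n$ (compact clopen). For every $x=(j_n)\in X$ one has $j_n\in\{0,\dots,h_n-2\}$ for all large $n$; let $\overline n$ be the smallest integer such that this holds for all $n\ge\overline n$, and set $T(x)=(j'_n)$ with $j'_n=j_n+1$ for $n\ge\overline n$ and, recursively, $j'_n=p_n(j'_{n+1})$ for $n<\overline n$. $\mu$ is the unique Borel measure on $X$ with $\mu(L_n^j)=3^{-n}$ for all $n\ge 0$, $0\le j<h_n$; it is infinite, $\sigma$-finite and $T$-invariant. **Definitions.** Let $(X,\mathcal A,\mu,T)$ be a conservative, ergodic, measure preserving dynamical system. It is *rationally ergodic* if there exist a set $B\in\mathcal A$ with $0<\mu(B)<\infty$ and a constant $M>0$ such that for any $r\ge1$, $$\int_B\Bigl(\sum_{0\le j\le r-1}\mathbf 1_B(T^jx)\Bigr)^2d\mu(x)\le M\Bigl(\int_B\sum_{0\le j\le r-1}\mathbf 1_B(T^jx)\,d\mu(x)\Bigr)^2.$$ A *measurable law of large numbers* for it is a measurable function $L:\{0,1\}^{\mathbb N}\to[0,\infty]$ such that for all $B\in\mathcal A$, for $\mu$-almost every $x\in X$, $L(\mathbf 1_B(x),\mathbf 1_B(Tx),\ldots)=\mu(B)$. *)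

(* Defs.v *)
From HB Require Import structures.
From mathcomp Require Import all_boot all_order all_algebra.
From mathcomp Require Import all_classical all_reals all_analysis.
From mathcomp Require Import measurable_realfun.
From mathcomp Require Import zify.

Set Implicit Arguments.
Unset Strict Implicit.
Unset Printing Implicit Defensive.

Import Order.TTheory GRing.Theory Num.Theory.

Local Open Scope classical_set_scope.
Local Open Scope ring_scope.

(** * Notions of infinite ergodic theory *)

Section dynamical_systems.
Context d (T : measurableType d) (R : realType).
Implicit Types (mu : {measure set T -> \bar R}) (f : T -> T) (B : set T).

Definition measure_preserving mu f :=
  measurable_fun [set: T] f /\
  forall A, measurable A -> mu (f @^-1` A) = mu A.

(* every measurable wandering set is null *)
Definition conservative mu f :=
  forall W, measurable W ->
    trivIset [set: nat] (fun n => iter n f @^-1` W) -> mu W = 0%E.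

Definition ergodic mu f :=
  forall A, measurable A -> f @^-1` A = A -> mu A = 0%E \/ mu (~` A) = 0%E.

Definition conservative_ergodic_mps mu f :=
  [/\ measure_preserving mu f, conservative mu f & ergodic mu f].

Definition visits f B (r : nat) (x : T) : R :=
  (\sum_(0 <= j < r) \1_B (iter j f x))%R.

Definition rationally_ergodic mu f :=
  conservative_ergodic_mps mu f /\
  exists B (M : R), [/\ measurable B, (0 < mu B < +oo)%E, (0 < M)%R &
    forall r, (1 <= r)%N ->
      (\int[mu]_(x in B) (visits f B r x ^+ 2)%:E <=
       M%:E * (\int[mu]_(x in B) (visits f B r x)%:E) ^+ 2)%E].

End dynamical_systems.

(** The space {0,1}^N with its product sigma-algebra *)

Definition bit_cylinders : set (set (nat -> bool)) :=
  \bigcup_n preimage_set_system [set: nat -> bool] (fun w => w n) measurable.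

Definition bits : Type := nat -> bool.

HB.instance Definition _ :=
  Measurable.copy bits (g_sigma_algebraType bit_cylinders).

Definition admits_measurable_lln d (T : measurableType d) (R : realType)
    (mu : {measure set T -> \bar R}) (f : T -> T) :=
  exists L : bits -> \bar R,
    [/\ forall w, (0 <= L w)%E, measurable_fun [set: bits] L &
      forall B : set T, measurable B ->
        {ae mu, forall x, L (fun n => iter n f x \in B) = mu B}].

(** * The nearly finite Chacon transformation *)

(* [level] is the sequence (n_l), which is indexed by l >= 1: the value
   [level 0] is irrelevant *)
Record chacon_params := ChaconParams {
  ell : nat -> nat ;
  level : nat -> nat ;
  ell_0 : ell 0 = 1%N ;
  ell_increasing : forall k, (ell k < ell k.+1)%N ;
  ell_growth : forall k,
    (2 <= (1 + 7 ^- k) ^+ (ell k.+1 - ell k) :> rat)%R ;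
  level_1 : (1 < level 1)%N ;
  level_increasing : forall l, (1 <= l)%N -> (level l < level l.+1)%N ;
  level_gap : forall l, (2 <= l)%N -> (level l.-1 + 2 * l < level l)%N
}.

Section chacon.
Variable P : chacon_params.

(* k(l) for l >= 1 *)
Definition epoch (l : nat) : nat :=
  xget 0%N [set k | (ell P k <= l < ell P k.+1)%N].

(* a_n as a function of the heights h_0, ..., h_n; the truncated subtraction is
   a true one since k(l) < l < n_l *)
Definition spacers_of (h : nat -> nat) (n : nat) : nat :=
  let S := [set l | (1 <= l)%N /\ level P l = n] in
  if pselect (S !=set0) then h (n - epoch (xget 0%N S))%N else 0%N.

(* [heights n] agrees with h on {0, ..., n} *)
Fixpoint heights (n : nat) : nat -> nat :=
  if n is m.+1 then
    fun i => if (i <= m)%N then heights m i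
             else (3 * heights m m + 3 * spacers_of (heights m) m + 1)%N
  else fun=> 1%N.

Definition height n := heights n n.

Definition spacers n := spacers_of height n.

Lemma heights_le n i : (i <= n)%N -> heights n i = height i.
Proof.
elim: n => [|n IH]; first by rewrite leqn0 => /eqP ->.
by rewrite leq_eqVlt ltnS => /orP[/eqP -> //|le_in] /=; rewrite le_in IH.
Qed.

Lemma height0 : height 0 = 1%N. Proof. by []. Qed.

Lemma heightS n : height n.+1 = (3 * height n + 3 * spacers n + 1)%N.
Proof.
rewrite {1}/height /= ltnn; congr (_ + 3 * _ + _)%N.
rewrite /spacers /spacers_of.
by case: pselect => //= _; rewrite heights_le ?leq_subr.
Qed.

Lemma height_gt0 n : (0 < height n)%N.
Proof. by case: n => // n; rewrite heightS addn1. Qed.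

Lemma spacers_level l : (1 <= l)%N ->
  spacers (level P l) = height (level P l - epoch l)%N.
Proof.
move=> l1; rewrite /spacers /spacers_of.
set S := [set _ | _]; case: pselect => [exS|]; last by case; exists l.
have [] : S (xget 0%N S) by exact: xgetPex.
move: (xget 0%N S) => m m1 lm.
have lt_level i j : (1 <= i)%N -> (i < j)%N -> (level P i < level P j)%N.
  move=> i1; elim: j => // j IH; rewrite ltnS leq_eqVlt => /orP[/eqP <-|ij].
    exact: level_increasing.
  by apply: ltn_trans (IH ij) _; apply: level_increasing; lia.
case: (ltngtP m l) => [ml|lm'|->//].
  by have := lt_level _ _ m1 ml; rewrite lm ltnn.
by have := lt_level _ _ l1 lm'; rewrite lm ltnn.
Qed.

Lemma spacers_notin n : (forall l, (1 <= l)%N -> level P l <> n) ->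
  spacers n = 0%N.
Proof.
move=> nS; rewrite /spacers /spacers_of.
by case: pselect => // exS; case: exS => l [l1 ln]; case: (nS l l1).
Qed.

(* b_n^1, b_n^2, b_n^3 *)
Definition base1 (n : nat) : nat := 0%N.
Definition base2 n := (height n + spacers n)%N.
Definition base3 n := (2 * height n + 2 * spacers n + 1)%N.

(* the map p_n, with [None] for the point * *)
Definition proj_level (n : nat) (y : option nat) : option nat :=
  if y is Some j then
    if (base1 n <= j < base1 n + height n)%N then Some (j - base1 n)%N
    else if (base2 n <= j < base2 n + height n)%N then Some (j - base2 n)%N
    else if (base3 n <= j < base3 n + height n)%N then Some (j - base3 n)%N
    else None
  else None.

Definition chacon_set :
    set (prod_topology (fun _ : nat => discrete_topology (option nat))) :=
  [set x | [/\ forall n, if x n is Some j then (j < height n)%N else true,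
              forall n, x n = proj_level n (x n.+1) &
              exists n, x n <> None]].

(* the subspace topology of the product of the discrete topologies *)
Definition chaconX : Type := set_type chacon_set.

HB.instance Definition _ := Topological.copy chaconX (set_type chacon_set).

Definition coord (n : nat) (x : chaconX) : option nat := (\val x) n.

Lemma chacon_set_zero : chacon_set (fun=> Some 0%N).
Proof.
split=> [n|n|]; [exact: height_gt0| |by exists 0%N].
by rewrite /proj_level /base1 /= add0n height_gt0.
Qed.

HB.instance Definition _ := isPointed.Build chaconX
  (SigSub (mem_set chacon_set_zero) : chaconX).

(* the Borel sigma-algebra *)
HB.instance Definition _ :=
  Measurable.copy chaconX (g_sigma_algebraType (@open chaconX)).

Definition tower_level (n j : nat) : set chaconX := [set x | coord n x = Some j].

Definition below_top (x : chaconX) (n : nat) : bool :=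
  if coord n x is Some j then (j.+1 < height n)%N else false.

Lemma proj_levelP n j i : proj_level n (Some j) = Some i ->
  (i < height n)%N /\ [\/ j = base1 n + i, j = base2 n + i | j = base3 n + i]%N.
Proof.
rewrite /proj_level; case: ifP => [c [<-]|_]; first by split; [lia|apply: Or31; lia].
case: ifP => [c [<-]|_]; first by split; [lia|apply: Or32; lia].
by case: ifP => [c [<-]|_] //; split; [lia|apply: Or33; lia].
Qed.

Lemma proj_level_base n j i : (i < height n)%N ->
  [\/ j = base1 n + i, j = base2 n + i | j = base3 n + i]%N ->
  proj_level n (Some j) = Some i.
Proof.
rewrite /proj_level /base1 /base2 /base3 => ih [] ->.
- by rewrite ifT; try lia; congr (Some _); lia.
- by rewrite ifF ?ifT; try lia; congr (Some _); lia.
- by rewrite ifF; try lia; rewrite ifF; try lia; rewrite ifT; try lia;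
    congr (Some _); lia.
Qed.

Lemma coordP x :
  [/\ forall n, if coord n x is Some j then (j < height n)%N else true,
      forall n, coord n x = proj_level n (coord n.+1 x) &
      exists n, coord n x <> None].
Proof. by case: x => x xX; exact: (set_mem xX). Qed.

Lemma eventually_below_top x :
  exists N, `[< forall n, (N <= n)%N -> below_top x n >].
Proof.
have [xh xp [n0 xn0]] := coordP x.
have xN n : (n0 <= n)%N -> coord n x <> None.
  move=> /subnKC <-; elim: (n - n0)%N => [|m IH]; first by rewrite addn0.
  by rewrite addnS => E; apply: IH; rewrite xp E.
have level_ge l : (l < level P l.+1)%N.
  elim: l => [|l IH]; first exact: (ltn_trans _ (level_1 P)).
  exact: leq_ltn_trans IH (level_increasing P _).
set q := level P n0.+1.
have q_ge : (n0 < q)%N := level_ge n0.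
have aq : (0 < spacers q)%N by rewrite spacers_level ?height_gt0.
exists q.+1; apply/asboolP => n /subnKC <-.
elim: (n - q.+1)%N => [|m IH]; [rewrite addn0|rewrite addnS].
  rewrite /below_top; have := xh q.+1; have := xp q; have := xN q.+1.
  have := xN q; case: (coord q.+1 x) => [j|] xq; last by move=> /(_ ltac:(lia)).
  move=> _; case: (coord q x) xq => [i|]; last by move=> /(_ ltac:(lia)).
  move=> _ /esym /proj_levelP; rewrite /base1 /base2 /base3 heightS.
  by move=> [ih] [] -> _; lia.
set r := (q.+1 + m)%N in IH *.
move: IH; rewrite /below_top; have := xp r; have := xN r.+1 ltac:(lia).
case: (coord r.+1 x) => [j|] // _.
case: (coord r x) => [i|] // /esym /proj_levelP.
by rewrite /base1 /base2 /base3 heightS => -[_] [] ->; lia.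
Qed.

Definition nbar (x : chaconX) : nat := ex_minn (eventually_below_top x).

(* [descend y k n] is p_n (p_{n+1} (... p_{n+k-1} (y (n + k)))) *)
Fixpoint descend (y : nat -> option nat) (k n : nat) : option nat :=
  if k is k'.+1 then proj_level n (descend y k' n.+1) else y n.

(* the coordinates j'_n of T x; the subtraction is 0 when n >= nbar x *)
Definition chacon_coords (x : chaconX) (n : nat) : option nat :=
  descend (fun m => omap succn (coord m x)) (nbar x - n) n.

Lemma chacon_coordsP x : chacon_set (chacon_coords x).
Proof.
have xtop n : (nbar x <= n)%N -> below_top x n.
  by rewrite /nbar; case: ex_minnP => N /asboolP + _; exact.
have [_ xp _] := coordP x.
have cE n : (nbar x <= n)%N -> chacon_coords x n = omap succn (coord n x).
  by rewrite /chacon_coords -subn_eq0 => /eqP ->.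
have cp n : chacon_coords x n = proj_level n (chacon_coords x n.+1).
  case: (leqP (nbar x) n) => nx; last first.
    by rewrite /chacon_coords (ltac:(lia) : nbar x - n = (nbar x - n.+1).+1)%N.
  rewrite !cE ?(leqW nx) //; have := xtop n nx; have := xtop n.+1 (leqW nx).
  rewrite /below_top; have := xp n.
  case: (coord n.+1 x) => [j|] //; case: (coord n x) => [i|] // /esym pj _ ni.
  apply/esym/proj_level_base => //.
  by have [_ []] := proj_levelP pj => ->; rewrite -addnS;
    [apply: Or31|apply: Or32|apply: Or33].
split=> // [n|].
  case: (leqP (nbar x) n) => nx.
    rewrite cE //; have := xtop n nx; rewrite /below_top.
    by case: (coord n x).
  rewrite cp; case: (chacon_coords x n.+1) => // j.
  by case E: (proj_level n _) => [i|] //; have [] := proj_levelP E.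
exists (nbar x); rewrite cE //; have := xtop _ (leqnn (nbar x)).
by rewrite /below_top; case: (coord _ x).
Qed.

Definition chaconT (x : chaconX) : chaconX :=
  SigSub (mem_set (chacon_coordsP x)).

(* the defining property of the measure mu; it determines mu among the Borel
   measures *)
Definition chacon_measure (R : realType) (mu : {measure set chaconX -> \bar R}) :=
  forall n j, (j < height n)%N -> mu (tower_level n j) = (3 ^- n)%:E.

End chacon.

(* Main.v *)
Require Import Defs.
From HB Require Import structures.
From mathcomp Require Import all_boot all_order all_algebra.
From mathcomp Require Import all_classical all_reals all_analysis.
From mathcomp Require Import measurable_realfun.
From mathcomp Require Import zify ring lra.

Set Implicit Arguments.
Unset Strict Implicit.
Unset Printing Implicit Defensive.

Import Order.TTheory GRing.Theory Num.Theory.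
Import numFieldNormedType.Exports.

Local Open Scope classical_set_scope.
Local Open Scope ring_scope.

(** The levels of the n-th tower are permuted upwards by T, so an invariant set
    has the same relative measure d in all levels of all towers; hence
    mu (A `&` E) = d * mu E for every E, and E := ~` A gives ergodicity.  A set W
    with disjoint preimages meets the n-th tower in measure at most 3^-n, since
    its parts in the levels can be pulled back to disjoint subsets of the base.

    Let B be the bottom level of the 0-th tower.  Every return to a level of the
    n-th tower takes at least h_n steps and 3^n levels of this tower lie in B, so
    an orbit visits B at most 3^n times before time h_n.  Conversely a third of B
    visits it at least 3^(n-1) times before time h_n.  Comparing with
    h_n <= r < h_(n+1) yields rational ergodicity.  By ergodicity
    limsup_n S_(h_n)(B) / 3^n is almost everywhere a constant k with
    1/3 <= k <= 1.  Hopf's maximal inequality bounds q S_r(B) - S_r(A) from above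
    in r, for almost every x, when q < mu(A), and bounds S_r(A) - q S_r(B) when
    mu(A) < q.  Hence limsup_n S_(h_n)(A) / 3^n = k mu(A) for every measurable A,
    which is a measurable law of large numbers. *)

(* [coord] is also the coordinate function of vector.v *)
Local Notation coord := Defs.coord.

(** * Coordinates and towers *)

Section towers.
Variable P : chacon_params.
Implicit Types (x y : chaconX P) (n m i j : nat).

Local Notation h := (height P).
Local Notation S := (@chaconT P).

Lemma height_lt n : (h n < h n.+1)%N.
Proof. by rewrite heightS; lia. Qed.

Lemma height_homo : {homo h : m n / (m <= n)%N}.
Proof. by apply: homo_leq leq_trans _ => // n; exact/ltnW/height_lt. Qed.

Lemma lt_height n : (n < h n)%N.
Proof. by elim: n => // n IH; exact: leq_ltn_trans IH (height_lt n). Qed.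

Lemma coord_proj x n : coord n x = proj_level P n (coord n.+1 x).
Proof. by have [_ + _] := coordP x; exact. Qed.

Lemma coord_lt x n j : coord n x = Some j -> (j < h n)%N.
Proof. by have [+ _ _] := coordP x => /(_ n); case: (coord _ x) => // k + [<-]. Qed.

Lemma coord_agree x y m n : (m <= n)%N -> coord n x = coord n y ->
  coord m x = coord m y.
Proof.
move=> /subnKC <-; elim: (n - m)%N => [|k IH]; first by rewrite addn0.
by rewrite addnS => E; apply: IH; rewrite coord_proj E -coord_proj.
Qed.

Lemma coord_neq_None x m n : (m <= n)%N -> coord m x <> None -> coord n x <> None.
Proof.
move=> /subnKC <-; elim: (n - m)%N => [|k IH]; first by rewrite addn0.
by move=> /IH; rewrite addnS coord_proj => + E; rewrite E.
Qed.

Lemma coord_base x n i : coord n x = Some i ->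
  [\/ coord n.+1 x = Some (base1 n + i)%N, coord n.+1 x = Some (base2 P n + i)%N
    | coord n.+1 x = Some (base3 P n + i)%N].
Proof.
rewrite coord_proj; case: (coord n.+1 x) => // j /proj_levelP[_] [] ->;
by [apply: Or31|apply: Or32|apply: Or33].
Qed.

Lemma base_coord x n i : (i < h n)%N ->
  [\/ coord n.+1 x = Some (base1 n + i)%N, coord n.+1 x = Some (base2 P n + i)%N
    | coord n.+1 x = Some (base3 P n + i)%N] ->
  coord n x = Some i.
Proof.
move=> ih ci; rewrite coord_proj.
case: ci => -> ; apply: proj_level_base => //;
by [apply: Or31|apply: Or32|apply: Or33].
Qed.

Lemma coord_shift_nbar x n : (nbar x <= n)%N ->
  coord n (S x) = omap succn (coord n x).
Proof.
by rewrite [LHS]/(chacon_coords x n) /chacon_coords -subn_eq0 => /eqP ->.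
Qed.

(** From [nbar x] on this is the definition of the map. Below it, a level is the union of three
    levels of the next tower, and adding one commutes with the three offsets, so the claim descends
    from [n.+1] to [n]. *)
Lemma coord_shiftS x n j : (j.+1 < h n)%N ->
  coord n (S x) = Some j.+1 <-> coord n x = Some j.
Proof.
elim: (nbar x - n)%N {-2}n j (leqnn (nbar x - n)%N) => {n} [|k IH] n j.
  rewrite leqn0 subn_eq0 => /coord_shift_nbar -> _.
  by case: (coord n x) => //= i; split=> [[->]|[->]].
move=> kn jh.
have b1 : (base1 n + j.+1 < h n.+1)%N by rewrite heightS /base1; lia.
have b2 : (base2 P n + j.+1 < h n.+1)%N by rewrite heightS /base2; lia.
have b3 : (base3 P n + j.+1 < h n.+1)%N by rewrite heightS /base3; lia.
have kn' : (nbar x - n.+1 <= k)%N by lia.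
rewrite addnS in b1; rewrite addnS in b2; rewrite addnS in b3.
have i1 := IH _ _ kn' b1; have i2 := IH _ _ kn' b2; have i3 := IH _ _ kn' b3.
split=> /coord_base; rewrite ?addnS => E; apply: base_coord; try lia.
  by case: E => [/i1|/i2|/i3] E; [apply: Or31|apply: Or32|apply: Or33].
by rewrite !addnS; case: E => [/i1|/i2|/i3] E;
  [apply: Or31|apply: Or32|apply: Or33].
Qed.

Lemma coord_iter x n j k : (j + k < h n)%N ->
  coord n (iter k S x) = Some (j + k)%N <-> coord n x = Some j.
Proof.
elim: k => [|k IH] jk; first by rewrite addn0.
by rewrite iterS addnS; apply: iff_trans (coord_shiftS _ _) (IH _); lia.
Qed.

Lemma coord_iter0 x n k : (k < h n)%N ->
  coord n (iter k S x) = Some k <-> coord n x = Some 0%N.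
Proof. exact: (@coord_iter x n 0 k). Qed.

(** If [k <= j], following the climb backwards puts [x] at level [j - k]. If [k > j], the orbit is
    at the bottom at time [k - j]; but as [k < h n], it is then still climbing from [j] and sits at
    level [k > 0]. *)
Lemma coord_return x n j k : (k < h n)%N -> coord n x = Some j ->
  coord n (iter k S x) = Some j -> k = 0%N.
Proof.
move=> kh xj kxj; have jh := coord_lt xj.
case: (leqP k j) => kj.
  have : coord n (iter k S x) = Some (j - k + k)%N by rewrite subnK.
  by rewrite coord_iter ?subnK // xj => -[]; lia.
have : coord n (iter (k - j) S x) = Some (0 + 0)%N.
  apply/(coord_iter _ (k := j)) => //; rewrite -iterD subnKC ?kxj //; exact: ltnW.
case: (ltnP (j + (k - j)) (h n)) => jkh; last by lia.
by have /coord_iter -/(_ _ jkh) -> := xj; move=> []; lia.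
Qed.

Lemma coord0_le x m n : (m <= n)%N -> coord n x = Some 0%N -> coord m x = Some 0%N.
Proof.
move=> /subnKC <-; elim: (n - m)%N => [|k IH]; first by rewrite addn0.
rewrite addnS => E; apply: IH; apply: base_coord; first exact: height_gt0.
by apply: Or31; rewrite E.
Qed.

(** The bottom level is entered from just below the second or third copy of some tower [n + k].
    Otherwise all coordinates of the image from [n] on would vanish, whereas from [nbar x] on they
    are successors. *)
Lemma coord_shift0 x n : coord n (S x) = Some 0%N <->
  exists k, coord (n + k).+1 x = Some (base2 P (n + k)).-1 \/
            coord (n + k).+1 x = Some (base3 P (n + k)).-1.
Proof.
have hg := height_gt0 P.
have b2 m : ((base2 P m).-1.+1 = base2 P m + 0)%N by have := hg m; rewrite /base2; lia.
have b3 m : ((base3 P m).-1.+1 = base3 P m + 0)%N by rewrite /base3; lia.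
have l2 m : ((base2 P m).-1.+1 < h m.+1)%N by rewrite heightS b2 /base2; have := hg m; lia.
have l3 m : ((base3 P m).-1.+1 < h m.+1)%N by rewrite heightS b3 /base3; have := hg m; lia.
split=> [E|[k E]]; last first.
  have {E} : coord (n + k) (S x) = Some 0%N.
    apply: base_coord => //.
    case: E => /coord_shiftS E; [apply: Or32; rewrite -b2|apply: Or33; rewrite -b3];
      exact: E.
  by apply: coord0_le; rewrite leq_addr.
apply: contrapT => /forallNP nE.
have all0 k : coord (n + k) (S x) = Some 0%N.
  elim: k => [|k IH]; first by rewrite addn0.
  have [] := coord_base IH; rewrite addnS // => E'; case: (nE k).
    by left; apply/coord_shiftS => //; rewrite b2.
  by right; apply/coord_shiftS => //; rewrite b3.
have := all0 (nbar x); rewrite coord_shift_nbar ?leq_addl //.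
by case: (coord _ x).
Qed.

(* the index at level 0 of the points which lie at height j of the n-th tower *)
Fixpoint ancestor (n : nat) (y : option nat) : option nat :=
  if n is m.+1 then ancestor m (proj_level P m y) else y.

Lemma coord_ancestor x n : coord 0 x = ancestor n (coord n x).
Proof. by elim: n => //= n ->; rewrite -coord_proj. Qed.

Lemma ancestor_None n : ancestor n None = None.
Proof. by elim: n. Qed.

End towers.

(** * The Borel sets *)

(** A product neighbourhood restricts only finitely many coordinates, and equality with [f] on these
    satisfies every restriction, whatever the factors are. *)
Lemma nbhs_prod_prefix (K : nat -> topologicalType) (f : prod_topology K)
    (A : set (prod_topology K)) : nbhs f A ->
  exists n, forall g, (forall m, (m <= n)%N -> g m = f m) -> A g.
Proof.
pose box n := [set g : prod_topology K | forall m, (m <= n)%N -> g m = f m].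
have FF : Filter (filter_from [set: nat] box).
  apply: filter_from_filter; first by exists 0%N.
  move=> i j _ _; exists (maxn i j) => // g gf; split=> m mi; apply: gf;
    by rewrite leq_max mi ?orbT.
(* convergence of the filter generated by the boxes is tested coordinatewise *)
suff H : filter_from [set: nat] box --> f by move=> /H[n _ nA]; exists n.
apply/cvg_sup => i B [C [[D oD DC] Cf] CB]; exists i => // g gf.
by apply: CB; rewrite -DC /= gf //; have : C f := Cf; rewrite -DC.
Qed.

Section borel.
Variable P : chacon_params.
Implicit Types (x y : chaconX P) (n m i j : nat).

Local Notation h := (height P).
Local Notation S := (@chaconT P).
Local Notation L := (@tower_level P).

Lemma open_tower_level n j : open (tower_level n j : set (chaconX P)).
Proof.
pose Y := prod_topology (fun _ : nat => discrete_topology (option nat)).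
rewrite (_ : tower_level n j =
    (set_val : chaconX P -> Y) @^-1` ((fun f : Y => f n) @^-1` [set Some j])) //.
apply: open_comp => [? _|]; first exact: initial_continuous.
apply: open_comp => [? _|]; last exact: discrete_open.
exact: (@proj_continuous _ (fun _ => discrete_topology (option nat)) n).
Qed.

(** The levels form a basis: a coordinate determines all earlier ones, so a single level fixes a
    whole prefix. It is taken late enough for [x] to have left the point [None]. *)
Lemma open_tower_levelP (U : set (chaconX P)) x : open U -> U x ->
  exists n j, L n j x /\ L n j `<=` U.
Proof.
move=> [C oC CU] Ux; have [_ _ [n0 xn0]] := coordP x.
have [|n nC] := @nbhs_prod_prefix _ (set_val x) C.
  by apply: open_nbhs_nbhs; split=> //; move: Ux; rewrite -CU.
have /coord_neq_None := xn0 => /(_ _ (leq_maxl n0 n)).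
case E : (coord _ x) => [j|] // _; exists (maxn n0 n), j; split=> // y yj.
rewrite -CU; apply: nC => m mn.
by apply: (@coord_agree _ _ _ _ (maxn n0 n)); rewrite ?E // leq_max mn orbT.
Qed.

Lemma measurable_tower_level n j : measurable (L n j : set (chaconX P)).
Proof. by apply: sub_sigma_algebra; exact: open_tower_level. Qed.

Definition levels : set (set (chaconX P)) :=
  [set A | A = set0 \/ exists n j, A = L n j].

(** One sequence running through all levels, with the empty set at numbers that code no pair. It
    makes covers and unions by levels countable. *)
Definition level_enum (k : nat) : set (chaconX P) :=
  if unpickle k is Some (n, j) then L n j else set0.

Lemma levels_enum k : levels (level_enum k).
Proof.
by rewrite /level_enum; case: (unpickle k) => [[n j]|]; [right; exists n, j|left].
Qed.

Lemma level_enumE n j : level_enum (pickle (n, j)) = L n j.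
Proof. by rewrite /level_enum pickleK. Qed.

Lemma bigcup_level_enum : \bigcup_k level_enum k = setT.
Proof.
rewrite -subTset => x _; have [_ _ [n]] := coordP x.
case E : (coord n x) => [j|] // _; exists (pickle (n, j)) => //.
by rewrite level_enumE.
Qed.

(** Two levels are nested or disjoint, since the later coordinate determines the earlier one; the
    disjoint case is why [levels] contains the empty set. *)
Lemma setI_levels : setI_closed levels.
Proof.
have sub m n j i : (m <= n)%N -> levels (L m i `&` L n j).
  move=> mn; have [->|/set0P[x [xi xj]]] := eqVneq (L m i `&` L n j) set0.
    by left.
  right; exists n, j; apply/seteqP; split=> [y []//|y yj]; split=> //.
  by rewrite /tower_level /= (coord_agree mn (y := x)) //; rewrite xj.
move=> A B [->|[m [i ->]]]; first by rewrite set0I; left.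
move=> [->|[n [j ->]]]; first by rewrite setI0; left.
by case/orP: (leq_total m n) => ?; [|rewrite setIC]; exact: sub.
Qed.

(** Every open set is the union of the levels that it contains, and there are countably many. *)
Lemma measurable_levels : @measurable _ (chaconX P) = <<s levels >>.
Proof.
apply/seteqP; split; last first.
  apply: smallest_sub; first exact: sigma_algebra_measurable.
  by move=> _ [->|[n [j ->]]]; [exact: measurable0|exact: measurable_tower_level].
apply: smallest_sub; first exact: smallest_sigma_algebra.
move=> U oU.
pose V k := if `[< level_enum k `<=` U >] then level_enum k else set0.
rewrite (_ : U = \bigcup_k V k); last first.
  apply/seteqP; split=> [x Ux|x [k _]]; last first.
    by rewrite /V; case: asboolP => // kU; exact: kU.
  have [n [j [xj jU]]] := open_tower_levelP oU Ux.
  by exists (pickle (n, j)) => //; rewrite /V level_enumE asboolT.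
apply: (@bigcupT_measurable _ (g_sigma_algebraType levels)) => k.
apply: sub_sigma_algebra; rewrite /V; case: asboolP => _; last by left.
exact: levels_enum.
Qed.

Lemma chacon_shift_level n j : (j.+1 < h n)%N -> S @^-1` L n j.+1 = L n j.
Proof.
by move=> jh; apply/seteqP; split=> x /=; rewrite /tower_level /= coord_shiftS.
Qed.

(** The points that the map sends to the bottom of the second or third copy of the n-th tower inside
    the next one. *)
Definition top_return n : set (chaconX P) :=
  L n.+1 (base2 P n).-1 `|` L n.+1 (base3 P n).-1.

Lemma chacon_shift_level0 n : S @^-1` L n 0 = \bigcup_k top_return (n + k).
Proof.
apply/seteqP; split=> x /=.
  by move=> /coord_shift0[k xk]; exists k.
by move=> [k _ xk]; apply/coord_shift0; exists k.
Qed.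

Lemma tower_level_height n j : (h n <= j)%N -> L n j = set0.
Proof.
by move=> jh; rewrite -subset0 => x /coord_lt; rewrite ltnNge jh.
Qed.

Lemma measurable_top_return n : measurable (top_return n).
Proof. by apply: measurableU; exact: measurable_tower_level. Qed.

Lemma measurable_chaconT : measurable_fun [set: chaconX P] S.
Proof.
apply: (measurability levels measurable_levels) => _ [B lB <-].
rewrite setTI; case: lB => [->|[n [j ->]]]; first by rewrite preimage_set0.
case: (ltnP j (h n)) => [jh|/tower_level_height ->]; last by rewrite preimage_set0.
case: j jh => [|j] jh; last first.
  by rewrite chacon_shift_level //; exact: measurable_tower_level.
rewrite chacon_shift_level0; apply: bigcupT_measurable => k.
exact: measurable_top_return.
Qed.

End borel.

(** * Conservativity and ergodicity *)

Lemma cvg_expV3 (R : realType) : (fun n => 3 ^- n : R) @ \oo --> 0.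
Proof.
under eq_fun do rewrite -exprVn.
apply: cvg_expr; rewrite ger0_norm ?invf_lt1 //; lra.
Qed.

Section chacon_measure.
Variables (R : realType) (P : chacon_params).
Variable mu : {measure set (chaconX P) -> \bar R}.
Hypothesis hmu : chacon_measure mu.
Implicit Types (x y : chaconX P) (n m i j : nat).

Local Notation h := (height P).
Local Notation S := (@chaconT P).
Local Notation L := (@tower_level P).

Lemma mu_tower_level n j : (j < h n)%N -> mu (L n j) = (3 ^- n)%:E.
Proof. exact: hmu. Qed.

Lemma tower_level_lty n j : (mu (L n j) < +oo)%E.
Proof.
case: (ltnP j (h n)) => [/hmu -> |/tower_level_height ->]; first exact: ltry.
by rewrite measure0.
Qed.

Lemma eq_measure_levels (m1 m2 : {measure set (chaconX P) -> \bar R}) :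
  (forall n j, (j < h n)%N -> m1 (L n j) = m2 (L n j)) ->
  (forall n j, (j < h n)%N -> (m1 (L n j) < +oo)%E) ->
  forall A, measurable A -> m1 A = m2 A.
Proof.
move=> m12 m1oo A mA.
apply: (measure_unique (@levels P) (@level_enum P)) => //.
- exact: measurable_levels.
- exact: setI_levels.
- exact: levels_enum.
- exact: bigcup_level_enum.
- move=> _ [->|[n [j ->]]]; first by rewrite !measure0.
  by case: (ltnP j (h n)) => [/m12 //|/tower_level_height ->]; rewrite !measure0.
- move=> k; rewrite /level_enum; case: unpickle => [[n j]|]; rewrite ?measure0 //.
  by case: (ltnP j (h n)) => [/m1oo //|/tower_level_height ->]; rewrite !measure0.
Qed.

Lemma mu_top_return n : mu (@top_return P n) = (2 * 3 ^- n.+1)%:E.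
Proof.
have hg := height_gt0 P n.
transitivity (mu (L n.+1 (base2 P n).-1) + mu (L n.+1 (base3 P n).-1))%E.
  apply: measureU; try exact: measurable_tower_level.
  by rewrite -subset0 => x []; rewrite /tower_level /= => -> []; rewrite /base2 /base3; lia.
rewrite !mu_tower_level; try by rewrite heightS /base2 /base3; lia.
by rewrite -EFinD; congr (_%:E); ring.
Qed.

Lemma top_return_shift n x : @top_return P n x ->
  coord n (S x) = Some 0%N /\ coord n.+1 (S x) <> Some 0%N.
Proof.
have hg := height_gt0 P n.
move=> nx; split; first by apply/coord_shift0; exists 0%N; rewrite addn0.
have E3 : (base3 P n).-1.+1 = base3 P n by rewrite /base3; lia.
have E2 : (base2 P n).-1.+1 = base2 P n by rewrite /base2; lia.
by case: nx => /coord_shiftS ->; rewrite ?E2 ?E3 ?heightS /base2 /base3 //;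
  first [lia | case; lia].
Qed.

(** The stage can be read off the image: it is the last one at which the image lies in the bottom
    level of the tower. *)
Lemma trivIset_top_return n : trivIset setT (fun k => @top_return P (n + k)).
Proof.
have lt k l x : (k < l)%N -> @top_return P (n + k) x -> ~ @top_return P (n + l) x.
  move=> kl /top_return_shift[_ E] /top_return_shift[F _]; apply: E.
  have kl' : ((n + k).+1 <= n + l)%N by lia.
  exact: coord0_le kl' F.
apply/trivIsetP => k l _ _; rewrite neq_ltn => kl.
rewrite -subset0 => x [xk xl].
by case/orP: kl => kl; [apply: (lt _ _ _ kl xk xl)|apply: (lt _ _ _ kl xl xk)].
Qed.

(** The pieces [top_return (n + k)] have measures [2 * 3 ^- (n + k).+1], a geometric series with sum
    [3 ^- n]. *)
Lemma mu_shift_level0 n : mu (S @^-1` L n 0) = (3 ^- n)%:E.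
Proof.
rewrite chacon_shift_level0.
have /(_ (fun k => @measurable_top_return P (n + k)) (@trivIset_top_return n)) :=
  @measure_sigma_additive _ _ _ mu (fun k => @top_return P (n + k)).
move/cvg_unique; apply; first exact: ereal_hausdorff.
have -> : (fun k => (\sum_(0 <= i < k) mu (@top_return P (n + i)))%E) =
    EFin \o (fun k => 3 ^- n * (1 - 3^-1 ^+ k)).
  apply/funext => k /=; elim: k => [|k IH].
    by rewrite big_geq // expr0 subrr mulr0.
  rewrite big_nat_recr //= IH mu_top_return -EFinD; congr (_%:E).
  by rewrite -addnS exprD !exprS exprVn; field; rewrite !expf_neq0.
apply: cvg_EFin; first exact: nearW.
rewrite [X in _ --> X](_ : _ = 3 ^- n * (1 - 0)); last by rewrite subr0 mulr1.
apply: cvgM; [exact: cvg_cst|apply: cvgB; first exact: cvg_cst].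
apply: cvg_expr; rewrite ger0_norm ?invf_lt1 //; lra.
Qed.

Lemma measure_preserving_chaconT : measure_preserving mu S.
Proof.
split=> [|A mA]; first exact: measurable_chaconT.
have mS := @measurable_chaconT P.
(* the measure structure of the pushforward depends on [mS]: it is not inferred *)
pose nu := measure_function_pushforward__canonical__measure_function_Measure mu mS.
suff : forall A, measurable A -> mu A = nu A by move=> /(_ A mA) ->.
apply: eq_measure_levels => [n j jh|n j _]; last exact: tower_level_lty.
rewrite /nu /= /pushforward mu_tower_level //.
case: j jh => [|j] jh; first by rewrite mu_shift_level0.
by rewrite chacon_shift_level // mu_tower_level // ltnW.
Qed.

Lemma measurable_iter k (A : set (chaconX P)) :
  measurable A -> measurable (iter k S @^-1` A).
Proof.
elim: k A => // k IH A mA.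
have := IH _ (measurable_chaconT measurableT mA); rewrite setTI.
by congr measurable; apply/seteqP; split=> x /=; rewrite iterS.
Qed.

Lemma mu_iter k (A : set (chaconX P)) :
  measurable A -> mu (iter k S @^-1` A) = mu A.
Proof.
have [_ muS] := measure_preserving_chaconT.
elim: k A => // k IH A mA.
have mSA : measurable (S @^-1` A).
  by rewrite -[X in measurable X]setTI; exact: measurable_chaconT.
by rewrite -(muS _ mA) -(IH _ mSA).
Qed.

Lemma tower_cover N n j : (n <= N)%N ->
  L n j `<=` \big[setU/set0]_(i < h N) L N i.
Proof.
move=> nN x xj; rewrite -bigcup_mkord.
have /(coord_neq_None nN) : coord n x <> None by rewrite xj.
case E : (coord N x) => [i|] // _; exists i => //=; exact: coord_lt E.
Qed.

Lemma trivIset_level N : trivIset setT (fun i : 'I_(h N) => L N i).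
Proof.
apply/trivIsetP => i j _ _ /eqP ij; rewrite -subset0 => x [].
by rewrite /tower_level /= => -> [] /val_inj.
Qed.

Lemma mu_tower (A : set (chaconX P)) N : measurable A ->
  mu (A `&` \big[setU/set0]_(i < h N) L N i) =
  (\sum_(i < h N) mu (A `&` L N i))%E.
Proof.
move=> mA; rewrite big_distrr /=; apply: measure_bigsetU_ord => [i|].
  by apply: measurableI => //; exact: measurable_tower_level.
by apply: trivIset_setIl; exact: trivIset_level.
Qed.

(** Carries the part of [A] in any level down to the bottom level, with the same measure because the
    map preserves [mu]. *)
Lemma preimage_iter_level (A : set (chaconX P)) N i : (i < h N)%N ->
  iter i S @^-1` (A `&` L N i) = L N 0 `&` iter i S @^-1` A.
Proof.
move=> iN; rewrite setIC.
by apply/seteqP; split=> x /= [/(coord_iter0 _ iN) xi Ax]; split.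
Qed.

Lemma conservative_chaconT : conservative mu S.
Proof.
move=> W mW tW.
have mL N : measurable (L N 0) by exact: measurable_tower_level.
have mWi i : measurable (iter i S @^-1` W) by exact: measurable_iter.
(* The parts of [W] in the levels, pulled back to the bottom, lie in distinct preimages of [W] and
   hence are disjoint. A fixed level lies in all later towers, so this bound tends to zero on it. *)
have bound N : (mu (W `&` \big[setU/set0]_(i < h N) L N i) <= (3 ^- N)%:E)%E.
  rewrite mu_tower //.
  have -> : (\sum_(i < h N) mu (W `&` L N i) =
      \sum_(i < h N) mu (L N 0 `&` iter i S @^-1` W))%E.
    apply: eq_bigr => i _; rewrite -preimage_iter_level // mu_iter //.
    by apply: measurableI => //; exact: measurable_tower_level.
  rewrite -(mu_tower_level (height_gt0 P N)).
  have <- : mu (\big[setU/set0]_(i < h N) (L N 0 `&` iter i S @^-1` W)) =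
      (\sum_(i < h N) mu (L N 0 `&` iter i S @^-1` W))%E.
    apply: measure_bigsetU_ord => [i|]; first exact: measurableI.
    apply: trivIset_setIl; apply/trivIsetP => i j _ _ ij.
    by move/trivIsetP : tW; apply.
  rewrite -big_distrr /=; apply: le_measure; rewrite ?inE //.
  by apply: measurableI => //; apply: bigsetU_measurable.
have null n j : mu (W `&` L n j) = 0%E.
  have mWn : measurable (W `&` L n j).
    by apply: measurableI => //; exact: measurable_tower_level.
  apply/eqP; rewrite -measure_le0.
  have c0 : (EFin \o (fun N => 3 ^- N : R)) N @[N --> \oo] --> 0%:E.
    by apply: cvg_EFin; [exact: nearW|exact: cvg_expV3].
  apply: (cvge_to_ge c0).
  near=> N; apply: le_trans (bound N); apply: le_measure; rewrite ?inE //.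
    apply: measurableI => //; apply: bigsetU_measurable => i _.
    exact: measurable_tower_level.
  by apply: setIS; apply: tower_cover; near: N; exact: nbhs_infty_ge.
apply: measure_negligible => //.
rewrite -(setIT W) -bigcup_level_enum setI_bigcupr.
apply: negligible_bigcup => k.
rewrite /level_enum; case: unpickle => [[n j]|]; last first.
  by rewrite setI0; exact: negligible_set0.
by apply/negligibleP; [apply: measurableI => //; exact: measurable_tower_level|exact: null].
Unshelve. all: by end_near. Qed.

Lemma ergodic_chaconT : ergodic mu S.
Proof.
move=> A mA SA.
have mL n j : measurable (L n j) by exact: measurable_tower_level.
have iterA k : iter k S @^-1` A = A.
  by elim: k => // k IH; rewrite -[RHS]IH -[in RHS]SA.
have Alevel n j : (j < h n)%N -> mu (A `&` L n j) = mu (A `&` L n 0).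
  move=> jn; have mAj : measurable (A `&` L n j) by exact: measurableI.
  by rewrite -(mu_iter j mAj) preimage_iter_level // iterA setIC.
have level0 n : L n 0 = L n.+1 (base1 n) `|` (L n.+1 (base2 P n) `|` L n.+1 (base3 P n)).
  apply/seteqP; split=> x /=.
    by move=> /coord_base; rewrite !addn0 => -[]; [left|right; left|right; right].
  move=> bx; apply: base_coord; first exact: height_gt0.
  by rewrite !addn0; case: bx => [?|[?|?]]; [apply: Or31|apply: Or32|apply: Or33].
(* The bottom level splits into three levels of the next tower, which carry equal parts of the
   invariant set [A]. *)
have AS n : mu (A `&` L n 0) = (3%:E * mu (A `&` L n.+1 0))%E.
  have hg := height_gt0 P n.
  have dis i j : i <> j -> (A `&` L n.+1 i) `&` (A `&` L n.+1 j) = set0.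
    move=> ij; rewrite -subset0 => x [[_ xi] [_ xj]]; apply: ij; move: xi.
    by rewrite /tower_level /= xj => -[].
  have mAL i : measurable (A `&` L n.+1 i) by exact: measurableI.
  rewrite level0 !setIUr.
  transitivity (mu (A `&` L n.+1 (base1 n)) + (mu (A `&` L n.+1 (base2 P n)) +
      mu (A `&` L n.+1 (base3 P n))))%E.
    rewrite -measureU //; last by apply: dis; rewrite /base2 /base3; lia.
    rewrite -measureU //; first exact: measurableU.
    by rewrite setIUr !dis ?setU0 // /base1 /base2 /base3; lia.
  rewrite !Alevel; try by rewrite heightS /base1 /base2 /base3; lia.
  rewrite (_ : 3 = 1 + (1 + 1)) ?EFinD; last by rewrite -natr1 -[in X in X + _]natr1; ring.
  by rewrite !ge0_muleDl ?mul1e // lee_fin.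
have dfin : mu (A `&` L 0 0) \is a fin_num.
  rewrite ge0_fin_numE //; apply: le_lt_trans (tower_level_lty 0 0).
  by apply: le_measure; rewrite ?inE //; exact: measurableI.
have AL n : mu (A `&` L n 0) = (fine (mu (A `&` L 0 0)) * 3 ^- n)%:E.
  elim: n => [|n IH]; first by rewrite expr0 invr1 mulr1 fineK.
  have := AS n; rewrite IH.
  case: (mu (A `&` L n.+1 0)) => [r [E]| |].
  - by congr (_%:E); rewrite exprS invfM mulrCA E; field.
  - by rewrite gt0_muley // lte_fin.
  - by rewrite gt0_muleNy // lte_fin.
have d0 : 0 <= fine (mu (A `&` L 0 0)) by exact: fine_ge0.
pose d := NngNum d0.
(* Both sides are measures in [B] and agree on the levels. The complement of [A] then shows that [d]
   or its measure is zero, and [B := A] settles the case [d = 0]. *)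
have E : forall B, measurable B -> mrestr mu mA B = mscale d mu B.
  apply: eq_measure_levels => n j jn; rewrite /= /mrestr setIC Alevel // AL ?ltry //.
  by rewrite /mscale mu_tower_level.
have /eqP : (0 = d%:num%:E * mu (~` A))%E.
  rewrite -[RHS]/(mscale d mu _) -E; last exact: measurableC.
  by rewrite /mrestr setICl measure0.
rewrite eq_sym mule_eq0 => /orP[/eqP d00|/eqP]; last by right.
left; have := E _ mA; rewrite /mrestr setIid /mscale => ->.
by rewrite d00 mul0e.
Qed.

Lemma conservative_ergodic_chaconT : conservative_ergodic_mps mu S.
Proof.
split; [exact: measure_preserving_chaconT|exact: conservative_chaconT|].
exact: ergodic_chaconT.
Qed.

End chacon_measure.

(** * Rational ergodicity *)

Section visits_count.
Variables (R : realType) (P : chacon_params).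
Implicit Types (x y : chaconX P) (n m i j k r : nat).

Local Notation h := (height P).
Local Notation S := (@chaconT P).
Local Notation L := (@tower_level P).
Local Notation visits0 := (@visits _ _ R S (L 0 0)).

Lemma mem_level n j x : (x \in L n j) = (coord n x == Some j).
Proof. by apply/idP/eqP; rewrite inE. Qed.

(* the levels of the n-th tower that are contained in L 0 0 *)
Definition base_level n (i : 'I_(h n)) := ancestor P n (Some (i : nat)) == Some 0%N.

Lemma indic_base n x :
  \1_(L 0 0) x = \sum_(i < h n | base_level i) \1_(L n i) x :> R.
Proof.
under eq_bigr do rewrite indicE mem_level.
rewrite indicE mem_level (coord_ancestor x n).
case E : (coord n x) => [j|]; last by rewrite ancestor_None big1.
have jn := coord_lt E.
rewrite big_mkcond (bigD1 (Ordinal jn)) //= eqxx big1 => [|i ij].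
  by rewrite addr0 /base_level /=; case: ifP.
case: ifP => // _; case: eqP => // -[ji]; case/eqP: ij; exact: val_inj.
Qed.

Lemma visits_level_le1 n i r x : (r <= h n)%N ->
  \sum_(0 <= k < r) \1_(L n i) (iter k S x) <= 1 :> R.
Proof.
move=> rn; rewrite big_mkord.
have [[k xk]|nk] := pselect (exists k : 'I_r, coord n (iter k S x) = Some i); last first.
  rewrite big1 // => k _; rewrite indicE mem_level; case: eqP => // xk.
  by case: nk; exists k.
rewrite (bigD1 k) //= indicE mem_level xk eqxx big1 ?addr0 // => l lk.
rewrite indicE mem_level; case: eqP => // xl.
have lt (k1 k2 : 'I_r) : (k1 < k2)%N -> coord n (iter k1 S x) = Some i ->
    coord n (iter k2 S x) = Some i -> False.
  move=> k12 x1; rewrite -(subnK (ltnW k12)) iterD => x2.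
  have kh : (k2 - k1 < h n)%N by have := ltn_ord k2; lia.
  have := coord_return kh x1 x2; lia.
case: (ltngtP l k) => [/lt|/lt|/val_inj lk'] //; last by rewrite lk' eqxx in lk.
  by move=> /(_ xl xk).
by move=> /(_ xk xl).
Qed.

Lemma visits_baseE n r x : visits0 r x =
  \sum_(i < h n | base_level i) \sum_(0 <= k < r) \1_(L n i) (iter k S x).
Proof.
by rewrite exchange_big; apply: eq_bigr => k _; rewrite (indic_base n).
Qed.

Lemma visits_level_ge1 n i r x k : (k < r)%N -> coord n (iter k S x) = Some i ->
  1 <= \sum_(0 <= k < r) \1_(L n i) (iter k S x) :> R.
Proof.
move=> kr xk; rewrite big_mkord (bigD1 (Ordinal kr)) //= indicE mem_level xk eqxx.
by rewrite lerDl sumr_ge0.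
Qed.

Lemma visits_ge0 r x : 0 <= visits0 r x.
Proof. by rewrite sumr_ge0. Qed.

Lemma visits_mono x : {homo visits0 ^~ x : m n / (m <= n)%N >-> m <= n}.
Proof.
move=> m n mn; rewrite /visits [leRHS](@big_cat_nat _ _ _ m) //= lerDl.
by rewrite sumr_ge0.
Qed.

(** For [m = n] this is [L 0 0]; for [m = n.+1] it is the part of [L 0 0] in the first copy of the
    n-th tower. *)
Definition base_union m n : set (chaconX P) :=
  \big[setU/set0]_(i < h n | base_level i) L m i.

Lemma base_unionP m n x :
  base_union m n x <-> exists2 i : 'I_(h n), base_level i & coord m x = Some (i : nat).
Proof.
rewrite /base_union -bigcup_seq_cond; split=> [[i /andP[_ bi] xi]|[i bi xi]].
  by exists i.
by exists i => //=; rewrite mem_index_enum.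
Qed.

Lemma base_union_id n : base_union n n = L 0 0.
Proof.
apply/seteqP; split=> x.
  move=> /base_unionP[i /eqP bi xi].
  by rewrite /tower_level /= (coord_ancestor x n) xi.
rewrite /tower_level /= (coord_ancestor x n).
case E : (coord n x) => [j|]; last by rewrite ancestor_None.
move=> bj; apply/base_unionP; exists (Ordinal (coord_lt E)) => //; exact/eqP.
Qed.

Lemma base_unionS n : base_union n.+1 n `<=` L 0 0.
Proof.
move=> x /base_unionP[i bi xi]; rewrite -(base_union_id n).
by apply/base_unionP; exists i => //; apply: base_coord => //; apply: Or31.
Qed.

Lemma measurable_base_union m n : measurable (base_union m n).
Proof. by apply: bigsetU_measurable => i _; exact: measurable_tower_level. Qed.

(* the points of base_union n.+1 n still have to cross the second copy of the
   n-th tower before they leave the tower n.+1 *)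
Lemma visits_ge n x : base_union n.+1 n x ->
  \sum_(i < h n | base_level i) 1 <= visits0 (h n.+1) x.
Proof.
move=> /base_unionP[j _ xj]; rewrite (visits_baseE n); apply: ler_sum => i _.
have jn := ltn_ord j; have i_n := ltn_ord i.
have kh : (j + (base2 P n + i - j) < h n.+1)%N by rewrite heightS /base2; lia.
apply: (@visits_level_ge1 _ _ _ _ (base2 P n + i - j)); first by lia.
apply: base_coord => //; apply: Or32.
move: xj => /(coord_iter x kh) ->; congr Some; rewrite /base2; lia.
Qed.

Variable mu : {measure set (chaconX P) -> \bar R}.
Hypothesis hmu : chacon_measure mu.

Lemma mu_base_union m n : (n <= m)%N ->
  mu (base_union m n) = (\sum_(i < h n | base_level i) 3 ^- m)%:E.
Proof.
move=> nm; rewrite -sumEFin.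
transitivity (\sum_(i < h n | base_level i) mu (L m i))%E.
  apply: measure_bigsetU_ord => [i|]; first exact: measurable_tower_level.
  apply/trivIsetP => i j _ _ /eqP ij; rewrite -subset0 => x [].
  by rewrite /tower_level /= => -> [] /val_inj.
by apply: eq_bigr => i _; rewrite hmu // (leq_trans (ltn_ord i)) // height_homo.
Qed.

(** The count is read off the measure: these levels have measure [3 ^- n] each and partition
    [L 0 0], which has measure one. *)
Lemma sum_base n : \sum_(i < h n | base_level i) 1 = 3 ^+ n :> R.
Proof.
have := mu_base_union (leqnn n); rewrite base_union_id (hmu (height_gt0 P 0)).
rewrite expr0 invr1 => -[] E.
transitivity ((\sum_(i < h n | base_level i) 3 ^- n) * 3 ^+ n : R).
  by rewrite mulr_suml; apply: eq_bigr => i _; rewrite mulVf // expf_neq0.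
by rewrite -E mul1r.
Qed.

Lemma visits_le n r x : (r <= h n)%N -> visits0 r x <= 3 ^+ n.
Proof.
move=> rn; rewrite -sum_base (visits_baseE n); apply: ler_sum => i _.
exact: visits_level_le1.
Qed.

Lemma mu_base_unionS n : mu (base_union n.+1 n) = (3^-1)%:E.
Proof.
rewrite mu_base_union //; congr (_%:E).
rewrite (_ : \sum_(i < h n | _) _ = (\sum_(i < h n | base_level i) 1) * 3 ^- n.+1).
  by rewrite sum_base exprS; field; rewrite expf_neq0.
by rewrite mulr_suml; apply: eq_bigr => i _; rewrite mul1r.
Qed.

Lemma measurable_visits (B : set (chaconX P)) r : measurable B ->
  measurable_fun setT (@visits _ _ R S B r).
Proof.
move=> mB; apply: measurable_sum => k.
rewrite (_ : (fun x => _) = \1_(iter k S @^-1` B)) //.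
by apply: measurable_indic; exact: measurable_iter.
Qed.

Lemma mu_base : mu (L 0 0) = 1%E.
Proof. by rewrite (hmu (height_gt0 P 0)) expr0 invr1. Qed.

(** On a third of the base there are at least [3 ^+ n] visits before time [h n.+1], which integrate
    to [3 ^+ n / 3 = 9^-1 * 3 ^+ n.+1]. For [n = 0] the visit at time zero suffices. *)
Lemma integral_visits_ge n :
  ((9^-1 * 3 ^+ n)%:E <= \int[mu]_(x in L 0 0) (visits0 (h n) x)%:E)%E.
Proof.
have mB : measurable (L 0 0 : set (chaconX P)) by exact: measurable_tower_level.
have mV r : measurable_fun (L 0 0) (fun x => (visits0 r x)%:E).
  by apply/measurable_EFinP; apply: measurable_funTS; exact: measurable_visits.
case: n => [|n].
  rewrite expr0 mulr1; apply: (@le_trans _ _ (1 * mu (L 0 0))%E).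
    by rewrite mu_base mul1e lee_fin; lra.
  rewrite -integral_cst //; apply: ge0_le_integral => //=.
  by move=> x xB; rewrite lee_fin /visits big_nat1 /= indicE mem_set.
have mE := measurable_base_union n.+1 n.
apply: (@le_trans _ _ (\int[mu]_(x in base_union n.+1 n) (visits0 (h n.+1) x)%:E)%E).
  apply: (@le_trans _ _ ((3 ^+ n)%:E * mu (base_union n.+1 n))%E).
    by rewrite mu_base_unionS -EFinM lee_fin exprS; lra.
  rewrite -integral_cst //; apply: ge0_le_integral => //=.
  - by apply/measurable_EFinP; apply: measurable_funTS; exact: measurable_visits.
  - by move=> x xE; rewrite lee_fin -(sum_base n); exact: visits_ge.
apply: ge0_subset_integral => //; last exact: base_unionS.
by move=> x _; rewrite lee_fin; exact: visits_ge0.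
Qed.

Lemma height_bracket r : (1 <= r)%N -> exists n, (h n <= r < h n.+1)%N.
Proof.
move=> r1; have ex : exists n, (r < h n)%N by exists r; exact: lt_height.
case: (ex_minnP ex) => -[|n] rn nmin; first by rewrite height0 in rn; lia.
by exists n; rewrite rn andbT leqNgt; apply/negP => /nmin; rewrite ltnn.
Qed.

Lemma rationally_ergodic_chaconT : rationally_ergodic mu S.
Proof.
split; first exact: conservative_ergodic_chaconT.
have mB : measurable (L 0 0 : set (chaconX P)) by exact: measurable_tower_level.
have mV r : measurable_fun (L 0 0) (@visits _ _ R S (L 0 0) r).
  by apply: measurable_funTS; exact: measurable_visits.
(* The upper bound is the square of [3 * 3 ^+ n], the lower one that of [9^-1 * 3 ^+ n]; their ratio
   is [27 ^+ 2 = 729]. *)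
have [M ME] : exists M : R, M = 729 by exists 729.
have M0 : 0 < M by rewrite ME ltr0n.
exists (L 0 0), M; split=> // [|r /height_bracket[n /andP[nr rn]]].
  by rewrite mu_base lte01 ltry.
apply: (@le_trans _ _ (((3 ^+ n.+1) ^+ 2)%:E * mu (L 0 0))%E).
  rewrite -integral_cst //; apply: ge0_le_integral => //=.
  - by move=> x _; rewrite lee_fin sqr_ge0.
  - by apply/measurable_EFinP; exact: measurable_funX.
  - move=> x _; rewrite lee_fin lerXn2r ?nnegrE ?exprn_ge0 ?visits_ge0 //.
    by apply: visits_le; exact: ltnW.
rewrite mu_base mule1.
apply: (@le_trans _ _ (M%:E * ((9^-1 * 3 ^+ n)%:E ^+ 2))%E).
  rewrite expe2 -!EFinM lee_fin ME (exprS 3 n); set u := 3 ^+ n.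
  by rewrite le_eqVlt; apply/orP; left; apply/eqP; field.
apply: lee_pmul => //; [by rewrite lee_fin ltW|by rewrite expe_ge0 // lee_fin|].
have le : ((9^-1 * 3 ^+ n)%:E <= \int[mu]_(x in L 0 0) (visits0 r x)%:E)%E.
  apply: le_trans (integral_visits_ge n) _; apply: ge0_le_integral => //=.
  - by move=> x _; rewrite lee_fin; exact: visits_ge0.
  - exact/measurable_EFinP.
  - exact/measurable_EFinP.
  - by move=> x _; rewrite lee_fin; exact: visits_mono.
by rewrite !expe2; apply: lee_pmul => //; rewrite lee_fin.
Qed.

End visits_count.

(** * The maximal inequality *)

Definition birkhoff (T : Type) (R : nmodType) (f : T -> T) (g : T -> R)
    (r : nat) (x : T) : R :=
  \sum_(0 <= k < r) g (iter k f x).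

Lemma birkhoffS (T : Type) (R : nmodType) (f : T -> T) (g : T -> R) r x :
  birkhoff f g r.+1 x = g x + birkhoff f g r (f x).
Proof.
rewrite /birkhoff big_nat_recl //=; congr (_ + _).
by apply: eq_bigr => k _; rewrite -iterS iterSr.
Qed.

Lemma measurable_gt_real d (T : measurableType d) (R : realType) (g : T -> R) c :
  measurable_fun setT g -> measurable [set x | c < g x].
Proof.
move=> mg; rewrite -[X in measurable X]setTI.
rewrite (_ : [set x | _] = g @^-1` `]c, +oo[); first exact: mg.
by apply/seteqP; split=> x /=; rewrite in_itv /= andbT.
Qed.

Section maximal_inequality.
Context d (T : measurableType d) (R : realType) (mu : {measure set T -> \bar R}).
Variable f : T -> T.
Hypothesis mpf : measure_preserving mu f.
Variables p q : T -> R.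
Hypotheses (mp : measurable_fun setT p) (mq : measurable_fun setT q).
Hypotheses (p0 : forall x, 0 <= p x) (q0 : forall x, 0 <= q x).

(* the maximum of 0 and of the first n Birkhoff sums of p - q *)
Fixpoint max_birkhoff (n : nat) (x : T) : R :=
  if n is m.+1 then Num.max 0 (p x - q x + max_birkhoff m (f x)) else 0.

Lemma max_birkhoff_ge0 n x : 0 <= max_birkhoff n x.
Proof. by case: n => //= n; rewrite le_max lexx. Qed.

Lemma max_birkhoffS n x : max_birkhoff n x <= max_birkhoff n.+1 x.
Proof.
elim: n x => [|n IH] x; first exact: max_birkhoff_ge0.
by rewrite [leLHS]/= [leRHS]/= ge_max !le_max lexx /= lerD2l IH orbT.
Qed.

Lemma birkhoff_le_max n x :
  birkhoff f p n x - birkhoff f q n x <= max_birkhoff n x.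
Proof.
elim: n x => [|n IH] x; first by rewrite /birkhoff !big_geq // subrr.
rewrite !birkhoffS /= le_max; apply/orP; right; have := IH (f x); lra.
Qed.

Lemma measurable_max_birkhoff n : measurable_fun setT (max_birkhoff n).
Proof.
have [mf _] := mpf.
elim: n => [|n IH]; first exact: measurable_cst.
apply: measurable_maxr; first exact: measurable_cst.
apply: measurable_funD; first exact: measurable_funB.
exact: measurableT_comp.
Qed.

Lemma integral_comp_preserving (g : T -> R) : measurable_fun setT g ->
  (forall x, 0 <= g x) ->
  (\int[mu]_x (g (f x))%:E = \int[mu]_x (g x)%:E)%E.
Proof.
move=> mg g0; have [mf muf] := mpf.
have := @ge0_integral_pushforward _ _ _ _ R f mf mu setT (EFin \o g) measurableT.
rewrite preimage_setT => <-.
- by apply: eq_measure_integral => A mA _; rewrite /= /pushforward muf.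
- exact/measurable_EFinP.
- by move=> x _; rewrite lee_fin.
Qed.

Hypothesis int_p : (\int[mu]_x (p x)%:E < +oo)%E.

(** Dropping [q] bounds each maximum by [p] plus the previous maximum along the map. Finiteness
    allows this integral to be cancelled in the maximal inequality. *)
Lemma integral_max_birkhoff_lty n : (\int[mu]_x (max_birkhoff n x)%:E < +oo)%E.
Proof.
have [mf _] := mpf.
elim: n => [|n IH] /=; first by rewrite integral0 ltry.
have mMf : measurable_fun setT (max_birkhoff n \o f).
  by apply: measurableT_comp => //; exact: measurable_max_birkhoff.
apply: (@le_lt_trans _ _ (\int[mu]_x ((p x)%:E + (max_birkhoff n (f x))%:E))%E).
  apply: ge0_le_integral => //=.
  - by move=> x _; rewrite lee_fin (max_birkhoff_ge0 n.+1).
  - by apply/measurable_EFinP; exact: (measurable_max_birkhoff n.+1).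
  - by apply: emeasurable_funD; exact/measurable_EFinP.
  - move=> x _; rewrite -EFinD lee_fin ge_max.
    rewrite addr_ge0 ?p0 ?max_birkhoff_ge0 //= lerD2r.
    by rewrite lerBlDr lerDl.
rewrite ge0_integralD //; first last.
- exact/measurable_EFinP.
- by move=> x _; rewrite lee_fin max_birkhoff_ge0.
- exact/measurable_EFinP.
- by move=> x _; rewrite lee_fin.
rewrite lte_add_pinfty // integral_comp_preserving //.
- exact: measurable_max_birkhoff.
- exact: max_birkhoff_ge0.
Qed.

Definition max_positive n := [set x | 0 < max_birkhoff n x].

Lemma measurable_max_positive n : measurable (max_positive n).
Proof. exact/measurable_gt_real/measurable_max_birkhoff. Qed.

(** With [M] the maximum and [E] the set where it is positive, [1_E q + M <= p + M o f] pointwise: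
    on [E] the next maximum is [p - q + M o f], and off [E] one has [M = 0]. Integrate and cancel
    the integral of [M]. Keeping [p] and [q] apart allows [q] to have infinite integral. *)
Lemma maximal_inequality n :
  (\int[mu]_(x in max_positive n) (q x)%:E <= \int[mu]_x (p x)%:E)%E.
Proof.
have [mf _] := mpf.
have mM := measurable_max_birkhoff n.
have mE := measurable_max_positive n.
have mMf : measurable_fun setT (max_birkhoff n \o f) by exact: measurableT_comp.
have M0 x : (0 <= (max_birkhoff n x)%:E)%E by rewrite lee_fin max_birkhoff_ge0.
have Mfin : (\int[mu]_x (max_birkhoff n x)%:E)%E \is a fin_num.
  by rewrite ge0_fin_numE ?integral_max_birkhoff_lty // integral_ge0.
rewrite integral_mkcond /= -(leeD2rE _ _ Mfin).
have mqE : measurable_fun setT ((EFin \o q) \_ (max_positive n)).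
  by apply/(measurable_restrictT _ _).1 => //; apply/measurable_funTS/measurable_EFinP.
have qE0 x : (0 <= ((EFin \o q) \_ (max_positive n)) x)%E.
  by rewrite erestrict_ge0 // => y _; rewrite lee_fin.
rewrite -ge0_integralD //; last exact/measurable_EFinP.
rewrite -(integral_comp_preserving mM (max_birkhoff_ge0 n)).
rewrite -ge0_integralD //; first last.
- exact/measurable_EFinP.
- exact/measurable_EFinP.
- by move=> x _; rewrite lee_fin.
apply: ge0_le_integral => //=.
- by move=> x _; rewrite adde_ge0.
- by apply: emeasurable_funD => //; exact/measurable_EFinP.
- by apply: emeasurable_funD; exact/measurable_EFinP.
move=> x _; rewrite patchE; case: ifPn => [|/negP].
  rewrite inE /max_positive /= -!EFinD lee_fin => Mx.
  have := lt_le_trans Mx (max_birkhoffS n x); have := max_birkhoffS n x.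
  by rewrite /= lt_max ltxx /= => + pq; rewrite (max_idPr (ltW pq)); lra.
rewrite inE /max_positive /= => /negP; rewrite -leNgt => Mx.
rewrite add0e -EFinD lee_fin (le_trans Mx) // addr_ge0 //; exact: max_birkhoff_ge0.
Qed.

(** The increasing sets [max_positive n] exhaust [D], so monotone convergence passes the maximal
    inequality to the limit. *)
Lemma integral_le_of_unbounded (D : set T) : measurable D -> mu (~` D) = 0%E ->
  (forall x, D x -> exists r, 0 < birkhoff f p r x - birkhoff f q r x) ->
  (\int[mu]_x (q x)%:E <= \int[mu]_x (p x)%:E)%E.
Proof.
move=> mD D0 Dpos; have mE n := measurable_max_positive n.
have mq' : measurable_fun setT (EFin \o q) by exact/measurable_EFinP.
rewrite (@ge0_negligible_integral _ _ _ mu setT (~` D)) //; last 2 first.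
- exact: measurableC.
- by move=> x _; rewrite lee_fin.
rewrite setTD setCK.
apply: (@le_trans _ _ (\int[mu]_(x in \bigcup_n max_positive n) (q x)%:E)%E).
  apply: ge0_subset_integral => //; first exact: bigcupT_measurable.
  - exact: measurable_funTS.
  - by move=> x _; rewrite lee_fin.
  - move=> x /Dpos[r rx]; exists r => //=.
    exact: lt_le_trans rx (birkhoff_le_max r x).
have ndE : nondecreasing_seq max_positive.
  apply/nondecreasing_seqP => n; apply/subsetPset => x /= Mx.
  exact: lt_le_trans Mx (max_birkhoffS n x).
have := @ge0_nondecreasing_set_cvg_integral _ _ _ max_positive (EFin \o q) mu ndE mE.
move=> /(_ (fun n => measurable_funTS mq') ltac:(by move=> *; rewrite lee_fin)) cq.
apply: (cvge_to_le cq); apply: nearW => n; exact: maximal_inequality.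
Qed.

(* The points where the Birkhoff sums of p - q are unbounded above form an
   invariant set, on which some sum is positive; the maximal inequality excludes
   that this set is conull. *)
Lemma birkhoff_dominated : ergodic mu f ->
  (\int[mu]_x (p x)%:E < \int[mu]_x (q x)%:E)%E ->
  {ae mu, forall x, exists C, forall r, birkhoff f p r x <= birkhoff f q r x + C}.
Proof.
move=> ef pq; have [mf _] := mpf.
pose s r x := birkhoff f p r x - birkhoff f q r x.
have sS r x : s r.+1 x = p x - q x + s r (f x) by rewrite /s !birkhoffS; lra.
pose D := \bigcap_k \bigcup_r [set x | (k%:R : R) < s r x].
have mb (g : T -> R) r : measurable_fun setT g -> measurable_fun setT (birkhoff f g r).
  move=> mg; elim: r => [|r IH].
    rewrite (_ : birkhoff f g 0 = cst 0) //.
    by apply/funext => x; rewrite /birkhoff big_geq.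
  rewrite (_ : birkhoff f g r.+1 = g \+ (birkhoff f g r \o f)); last first.
    by apply/funext => x; rewrite birkhoffS.
  by apply: measurable_funD => //; exact: measurableT_comp.
have mD : measurable D.
  apply: bigcapT_measurable => k; apply: bigcupT_measurable => r.
  by apply/measurable_gt_real/measurable_funB; exact: mb.
have DE x : D x <-> forall C, exists r, C < s r x.
  split=> [Dx C|Dx k _]; last by have [r rx] := Dx k%:R; exists r.
  have [r _ rx] := Dx (Num.bound `|C|) I; exists r; apply: lt_trans rx.
  by apply: le_lt_trans (ler_norm C) _; exact: archi_boundP.
have s0 x : s 0%N x = 0 by rewrite /s /birkhoff !big_geq // subrr.
have invD : f @^-1` D = D.
  apply/seteqP; split=> x /DE Dx; apply/DE => C.
    by have [r rx] := Dx (C - (p x - q x)); exists r.+1; rewrite sS; lra.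
  (* The threshold is at least zero to exclude the empty sum, so that a first term can be split
     off. *)
  have [[|r]] := Dx (Num.max 0 (C + (p x - q x))).
    by rewrite s0 gt_max ltxx.
  by rewrite gt_max => /andP[_]; rewrite sS => rx; exists r; lra.
have [D0|D0] := ef D mD invD.
  exists D; split=> // x; apply: contra_notP => nDx.
  move: nDx => /DE/existsNP[C /forallNP nC]; exists C => r.
  by have /negP := nC r; rewrite -leNgt /s; lra.
have := integral_le_of_unbounded mD D0 (fun x Dx => (DE x).1 Dx 0).
by rewrite leNgt pq.
Qed.

End maximal_inequality.

(** * The law of large numbers *)

Lemma rat_between_ereal (R : realType) (x y : \bar R) : (x < y)%E ->
  exists q : rat, (x < (ratr q)%:E < y)%E.
Proof.
have real_case (a b : R) : a < b -> exists q : rat, (a%:E < (ratr q)%:E < b%:E)%E.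
  by move=> /rat_in_itvoo[q]; rewrite in_itv /= => ?; exists q; rewrite !lte_fin.
case: x y => [a| |] [b| |] //.
- by rewrite lte_fin => /real_case.
- move=> _; have [|q /andP[aq _]] := real_case a (a + 1); first by rewrite ltrDl.
  by exists q; rewrite aq ltry.
- move=> _; have [|q /andP[_ qb]] := real_case (b - 1) b; first by rewrite gtrBl.
  by exists q; rewrite qb ltNyr.
- by move=> _; exists 0%Q; rewrite ltry ltNyr.
Qed.

(** Comparison with rationals leaves countably many conditions, so that the exceptional null sets
    can be united. *)
Lemma eq_ereal_rat (R : realType) (x y : \bar R) :
  (forall q : rat, ((ratr q)%:E < x -> (ratr q)%:E <= y)%E) ->
  (forall q : rat, ((ratr q)%:E < y -> (ratr q)%:E <= x)%E) -> x = y.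
Proof.
move=> xy yx; apply/eqP; rewrite eq_le !leNgt; apply/andP; split; apply/negP.
  by move=> /rat_between_ereal[q /andP[yq /xy]]; rewrite leNgt yq.
by move=> /rat_between_ereal[q /andP[xq /yx]]; rewrite leNgt xq.
Qed.

Lemma ae_forall_rat d (T : measurableType d) (R : realType)
    (mu : {measure set T -> \bar R}) (A : rat -> T -> Prop) :
  (forall q, {ae mu, forall x, A q x}) -> {ae mu, forall x, forall q, A q x}.
Proof.
move=> Aq; have := ae_foralln 
  (P := fun n x => if unpickle n is Some q then A q x else True).
move=> /(_ _ mu) H.
have : \forall x \ae mu, forall n : nat, if unpickle n is Some q then A q x else True.
  by apply: H => n; case: unpickle => //=; apply: aeW.
by apply: filterS => x Ax q; have := Ax (pickle q); rewrite pickleK.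
Qed.

(** The sets where [g] exceeds a rational are invariant, hence null or conull, so almost all points
    define the same cut. Taking the constant as a value at a point of [G] transfers to it what is
    known of [g] on [G]. *)
Lemma ergodic_invariant_cst d (T : measurableType d) (R : realType)
    (mu : {measure set T -> \bar R}) (f : T -> T) (g : T -> \bar R) (G : set T) :
  ergodic mu f -> measurable_fun setT g -> (forall x, g (f x) = g x) ->
  measurable G -> mu G <> 0%E ->
  exists2 x0, G x0 & {ae mu, forall x, g x = g x0}.
Proof.
move=> ef mg gf mG G0.
pose A (q : rat) := [set x | ((ratr q)%:E < g x)%E].
have mA q : measurable (A q).
  rewrite -[X in measurable X]setTI; exact: emeasurable_fun_o_infty.
have invA q : f @^-1` A q = A q by apply/seteqP; split=> x; rewrite /A /= gf.
have /ae_forall_rat good q : {ae mu, forall x, A q x <-> mu (A q) <> 0%E}.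
  have [A0|A0] := ef _ (mA q) (invA q).
    exists (A q); split=> // x; apply: contra_notP => nAx.
    by split=> [/nAx //|/(_ A0)].
  (* A null complement alone does not decide whether [A q] is null; the exceptional set is chosen
     accordingly. *)
  have [Aq0|Aq0] := pselect (mu (A q) = 0%E).
    exists (A q); split=> // x; apply: contra_notP => nAx.
    by split=> [/nAx //|/(_ Aq0)].
  exists (~` A q); split=> //; first exact: measurableC.
  move=> x; apply: contra_notP => /contrapT Ax.
  by split=> // _; exact: contrapT.
have [x0 Gx0 x0good] : exists2 x0, G x0 & forall q, A q x0 <-> mu (A q) <> 0%E.
  apply: contrapT => /forall2NP nG; apply: G0; apply: measure_negligible => //.
  apply: negligibleS good => x Gx /= xgood.
  by have [] := nG x.
exists x0 => //; apply: filterS good => x xgood.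
apply: eq_ereal_rat => q qg; apply: ltW.
  by apply/(x0good q)/(xgood q).
by apply/(xgood q)/(x0good q).
Qed.

(** * Upper limits under affine comparison of sequences *)

Section limn_esup_real.
Variable R : realType.
Implicit Types (u v c : nat -> R) (k : R).

Lemma limn_esup_ltP (u : nat -> \bar R) y : (limn_esup u < y)%E ->
  exists N, forall n, (N <= n)%N -> (u n < y)%E.
Proof.
rewrite /limn_esup limf_esupE => /ereal_inf_lt[_ [V [N _ NV] <-] uy].
exists N => n Nn; apply: le_lt_trans uy; apply: ereal_sup_ubound.
by exists n => //; apply: NV.
Qed.

Lemma limn_esup_le (u : nat -> \bar R) y N :
  (forall n, (N <= n)%N -> (u n <= y)%E) -> (limn_esup u <= y)%E.
Proof.
move=> uy; rewrite /limn_esup limf_esupE.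
apply: le_trans (ereal_inf_lbound _) _.
  by exists [set n | (N <= n)%N] => //; exists N.
by apply: ge_ereal_sup => _ [n Nn <-]; exact: uy.
Qed.

Lemma limn_esup_ge (u : nat -> \bar R) y :
  (forall N, exists2 n, (N <= n)%N & (y <= u n)%E) -> (y <= limn_esup u)%E.
Proof.
move=> uy; rewrite leNgt; apply/negP => /limn_esup_ltP[N uN].
by have [n /uN un] := uy N; rewrite leNgt un.
Qed.

Lemma limn_esup_le_affine u v c a k : 0 <= a -> c @ \oo --> 0 ->
  limn_esup (EFin \o v) = k%:E -> (forall n, u n <= a * v n + c n) ->
  (limn_esup (EFin \o u) <= (a * k)%:E)%E.
Proof.
move=> a0 c0 vk uvc; apply/lee_addgt0Pr => e e0.
have a1 : 0 < a + 1 by rewrite ltr_wpDl.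
(* Chosen so that [a * e' + e' = e]: one share for [v], scaled by [a], and one for [c]. *)
pose e' := e / (a + 1); have e'0 : 0 < e' by rewrite divr_gt0.
have [|N vN] := @limn_esup_ltP (EFin \o v) (k + e')%:E.
  by rewrite vk lte_fin ltrDl.
have [M _ cM] : \forall n \near \oo, c n < e' by exact: (cvgr_lt _ c0).
apply: (@limn_esup_le _ _ (maxn N M)) => n; rewrite geq_max => /andP[/vN + /cM /=].
rewrite /= lte_fin -EFinD lee_fin => vn cn; apply: le_trans (uvc n) _.
have ae : a * e' + e' = e by rewrite /e'; field; rewrite gt_eqF.
rewrite -[in leRHS]ae addrA -mulrDr lerD ?ler_wpM2l //; exact: ltW.
Qed.

(** For [b > 0] and a finite upper limit of [u], dividing by [b] exchanges the roles of [u] and [v]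
    in the previous bound. *)
Lemma limn_esup_ge_affine u v c b k : 0 <= b -> c @ \oo --> 0 ->
  limn_esup (EFin \o v) = k%:E -> (forall n, 0 <= u n) ->
  (forall n, b * v n <= u n + c n) ->
  ((b * k)%:E <= limn_esup (EFin \o u))%E.
Proof.
move=> b0 c0 vk u0 buc.
have lu0 : (0 <= limn_esup (EFin \o u))%E.
  by apply: limn_esup_ge => N; exists N => //; rewrite lee_fin.
have [->|b_neq0] := eqVneq b 0; first by rewrite mul0r.
have b_gt0 : 0 < b by rewrite lt_def b_neq0.
move: lu0; case E : (limn_esup (EFin \o u)) => [l| |] // _; last by rewrite leey.
have bV0 : 0 <= b^-1 by rewrite invr_ge0.
have bc0 : (fun n => b^-1 * c n) @ \oo --> 0.
  by rewrite -[0](mulr0 b^-1); apply: cvgM => //; exact: cvg_cst.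
suff : k <= b^-1 * l by rewrite -(ler_pM2l b_gt0) mulVKf.
rewrite -lee_fin -vk; apply: (limn_esup_le_affine bV0 bc0 E) => n.
by rewrite -mulrDr -(ler_pM2l b_gt0) mulVKf.
Qed.

End limn_esup_real.

(** * The almost everywhere constant upper limit and the law of large numbers *)

Section chacon_lln.
Variables (R : realType) (P : chacon_params).
Variable mu : {measure set (chaconX P) -> \bar R}.
Hypothesis hmu : chacon_measure mu.
Implicit Types (x y : chaconX P) (n m i j k r : nat).

Local Notation h := (height P).
Local Notation S := (@chaconT P).
Local Notation L := (@tower_level P).
Local Notation visits0 := (@visits _ _ R S (L 0 0)).

(** The scale is the largest possible number of visits before time [h n], so the values stay in the
    unit interval. *)
Definition scaled_visits x n : R := visits0 (h n) x / 3 ^+ n.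

Definition limsup_visits x := limn_esup (EFin \o scaled_visits x).

Lemma scaled_visits_ge0 x n : 0 <= scaled_visits x n.
Proof. by rewrite divr_ge0 ?exprn_ge0 //; exact: visits_ge0. Qed.

Lemma scaled_visits_le1 x n : scaled_visits x n <= 1.
Proof. by rewrite ler_pdivrMr ?exprn_gt0 // mul1r; exact: (visits_le hmu). Qed.

Lemma limsup_visits_fin x : exists k : R, limsup_visits x = k%:E.
Proof.
exists (fine (limsup_visits x)); rewrite fineK // fin_numE.
have : (0 <= limsup_visits x)%E.
  by apply: limn_esup_ge => N; exists N => //; rewrite lee_fin scaled_visits_ge0.
have : (limsup_visits x <= 1)%E.
  by apply: (@limn_esup_le _ _ _ 0) => n _; rewrite lee_fin scaled_visits_le1.
by case: limsup_visits.
Qed.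

Lemma measurable_limsup_visits : measurable_fun setT limsup_visits.
Proof.
apply: measurable_fun_limn_esup => n; apply/measurable_EFinP.
by apply: measurable_funM => //; apply: measurable_visits; exact: measurable_tower_level.
Qed.

(** Shifting the orbit changes the count by at most one, that is by [3 ^- n] after scaling. *)
Lemma limsup_visits_shift x : limsup_visits (S x) = limsup_visits x.
Proof.
have c0 := @cvg_expV3 R.
have indic01 y : 0 <= (\1_(L 0 0) y : R) <= 1 by rewrite indicE; case: (_ \in _) => /=; lra.
have le (u v : R) n : u <= v + 1 -> u / 3 ^+ n <= 1 * (v / 3 ^+ n) + 3 ^- n.
  by rewrite mul1r ler_pdivrMr ?exprn_gt0 // mulrDl divfK ?mulVf ?expf_neq0.
have vS r : visits0 r.+1 x = \1_(L 0 0) x + visits0 r (S x) by exact: birkhoffS.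
have vS' r : visits0 r.+1 x = visits0 r x + \1_(L 0 0) (iter r S x).
  by rewrite /visits big_nat_recr.
have [k xk] := limsup_visits_fin x; have [l xl] := limsup_visits_fin (S x).
apply/eqP; rewrite eq_le; apply/andP; split.
  rewrite [leRHS]xk -[k]mul1r; apply: (limn_esup_le_affine _ c0 xk) => // n; apply: le.
  have := vS (h n); rewrite vS'; have := indic01 x; have := indic01 (iter (h n) S x); lra.
rewrite [leRHS]xl -[l]mul1r; apply: (limn_esup_le_affine _ c0 xl) => // n; apply: le.
have := vS (h n); rewrite vS'; have := indic01 x; have := indic01 (iter (h n) S x); lra.
Qed.

(** This makes the constant upper limit positive. The sets have measure one third inside a set of
    finite measure, so their upper limit is not null; a point in infinitely many of them has scaled
    count at least [3 ^+ n / 3 ^+ n.+1] infinitely often. *)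
Lemma lim_sup_base_union :
  let G := lim_sup_set (fun n => base_union n.+1 n : set (chaconX P)) in
  [/\ measurable G, mu G <> 0%E &
      forall x, G x -> ((3^-1)%:E <= limsup_visits x)%E].
Proof.
move=> G.
pose F n := base_union n.+1 n : set (chaconX P).
have mF n : measurable (F n) by exact: measurable_base_union.
split.
- apply: bigcap_measurable => // n _.
  by apply: bigcup_measurable => k _; exact: mF.
- have Foo : (mu (\bigcup_(k >= 0) F k) < +oo)%E.
    apply: le_lt_trans (tower_level_lty hmu 0 0); apply: le_measure; rewrite ?inE //.
    + by apply: bigcup_measurable => k _; exact: mF.
    + exact: measurable_tower_level.
    + by move=> x [k _]; exact: base_unionS.
  have := lim_sup_set_cvg mu F mF Foo.
  move=> /cvge_to_ge -/(_ (3^-1)%:E) H G0; move: H; rewrite -/G G0 => H.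
  have : ((3^-1 : R)%:E <= 0)%E.
    apply: H; apply: nearW => n; rewrite -(mu_base_unionS hmu n).
    apply: le_measure; rewrite ?inE.
    + exact: mF.
    + by apply: bigcup_measurable => k _; exact: mF.
    + by move=> x xn; exists n => /=.
  by rewrite lee_fin leNgt invr_gt0 ltr0n.
move=> x Gx; apply: limn_esup_ge => N.
have [n /= Nn xn] := Gx N I; exists n.+1; first exact: leqW.
rewrite lee_fin /scaled_visits ler_pdivlMr ?exprn_gt0 // exprS mulKf //.
by rewrite -(sum_base hmu n); exact: visits_ge.
Qed.

Lemma birkhoff_scale (c : R) (B : set (chaconX P)) r x :
  birkhoff S (fun y => c * \1_B y) r x = c * @visits _ _ R S B r x.
Proof. by rewrite /birkhoff /visits mulr_sumr. Qed.

(** The factors on both sides let the base be compared with a given set in either direction, and [B]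
    may have infinite measure. *)
Lemma visits_dominated (a b : R) (A B : set (chaconX P)) :
  measurable A -> measurable B -> 0 <= a -> 0 <= b ->
  (a%:E * mu A < +oo)%E -> (a%:E * mu A < b%:E * mu B)%E ->
  {ae mu, forall x, exists C, forall r,
    a * @visits _ _ R S A r x <= b * @visits _ _ R S B r x + C}.
Proof.
move=> mA mB a0 b0 aA ab.
have int (c : R) (D : set (chaconX P)) : 0 <= c -> measurable D ->
    (\int[mu]_x (c * \1_D x)%:E = c%:E * mu D)%E.
  move=> c0 mD; under eq_integral do rewrite EFinM.
  rewrite ge0_integralZl_EFin // ?integral_indic ?setIT //.
  by apply/measurable_EFinP; exact: measurable_indic.
have mc (c : R) (D : set (chaconX P)) : measurable D ->
    measurable_fun setT (fun x => c * \1_D x : R).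
  by move=> mD; apply: measurable_funM => //; exact: measurable_indic.
have c0 (c : R) (D : set (chaconX P)) x : 0 <= c -> 0 <= c * \1_D x.
  by move=> ?; rewrite mulr_ge0.
have := birkhoff_dominated (measure_preserving_chaconT hmu) (mc a A mA) (mc b B mB)
  (fun x => c0 a A x a0) (fun x => c0 b B x b0).
rewrite !int // => /(_ aA (ergodic_chaconT hmu) ab).
apply: filterS => x [C xC]; exists C => r; by have := xC r; rewrite !birkhoff_scale.
Qed.

Definition bit_freq (w : bits) n : R := (\sum_(0 <= i < h n) (w i)%:R) / 3 ^+ n.

(** Here [k] is to be the almost everywhere value of [limsup_visits], so that [L 0 0], of measure
    one, gets the value one. *)
Definition lln_functional (k : R) (w : bits) : \bar R :=
  (k^-1%:E * limn_esup (EFin \o bit_freq w))%E.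

Lemma measurable_lln_functional (k : R) : measurable_fun [set: bits] (lln_functional k).
Proof.
apply: emeasurable_funM; first exact: measurable_cst.
apply: measurable_fun_limn_esup => n; apply/measurable_EFinP.
apply: measurable_funM => //; apply: measurable_sum => i.
rewrite (_ : (fun w : bits => _) = \1_[set w : bits | w i]); last first.
  by apply/funext => w; rewrite indicE; congr ((nat_of_bool _)%:R);
    apply/idP/idP; rewrite inE.
apply: measurable_indic; apply: sub_sigma_algebra; exists i => //.
by exists [set true] => //; rewrite setTI; apply/seteqP; split.
Qed.

Lemma lln_chaconT : admits_measurable_lln mu S.
Proof.
have [mG G0 Glow] := lim_sup_base_union.
have [x0 Gx0 x0E] := ergodic_invariant_cst (ergodic_chaconT hmu)
  measurable_limsup_visits limsup_visits_shift mG G0.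
have [k kE] := limsup_visits_fin x0.
have k0 : 0 < k.
  have := Glow _ Gx0; rewrite kE lee_fin; apply: lt_le_trans.
  by rewrite invr_gt0 ltr0n.
have kV0 : (0 <= (k^-1)%:E)%E by rewrite lee_fin invr_ge0 ltW.
have mB0 : measurable (L 0 0 : set (chaconX P)) by exact: measurable_tower_level.
have L0 w : (0 <= lln_functional k w)%E.
  rewrite mule_ge0 //; apply: limn_esup_ge => N; exists N => //.
  by rewrite lee_fin divr_ge0 ?exprn_ge0 // sumr_ge0.
exists (lln_functional k); split=> //; first exact: measurable_lln_functional.
move=> B mB.
(* The conditions on [q] stand inside the almost everywhere statement, so that it holds for every
   rational and one null set serves them all. *)
have low q : {ae mu, forall x, 0 <= (ratr q : R) -> ((ratr q)%:E < mu B)%E ->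
    exists C : R, forall r, ratr q * visits0 r x <= 1 * @visits _ _ R S B r x + C}.
  have [q0|nq0] := pselect (0 <= (ratr q : R)); last by apply: aeW => x /nq0.
  have [qB|nqB] := pselect ((ratr q)%:E < mu B)%E; last by apply: aeW => x _ /nqB.
  have : {ae mu, forall x, exists C : R, forall r,
      ratr q * visits0 r x <= 1 * @visits _ _ R S B r x + C}.
    by apply: visits_dominated; rewrite ?(mu_base hmu) ?mule1 ?mul1e ?ltry.
  by apply: filterS.
have up q : {ae mu, forall x, (mu B < (ratr q)%:E)%E ->
    exists C : R, forall r, 1 * @visits _ _ R S B r x <= ratr q * visits0 r x + C}.
  have [qB|nqB] := pselect (mu B < (ratr q)%:E)%E; last by apply: aeW => x /nqB.
  have q0 : 0 <= (ratr q : R) by rewrite -lee_fin (le_trans _ (ltW qB)).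
  have : {ae mu, forall x, exists C : R, forall r,
      1 * @visits _ _ R S B r x <= ratr q * visits0 r x + C}.
    apply: visits_dominated; rewrite ?(mu_base hmu) ?mule1 ?mul1e //.
    by apply: lt_trans qB _; rewrite ltry.
  by apply: filterS.
have C0 (C : R) : (fun n => C * 3 ^- n) @ \oo --> 0.
  by rewrite -[0](mulr0 C); apply: cvgM; [exact: cvg_cst|exact: cvg_expV3].
apply: filterS3 (ae_forall_rat low) (ae_forall_rat up) x0E => x xlow xup xk.
have vk : limn_esup (EFin \o scaled_visits x) = k%:E by rewrite -kE -xk.
pose u n := @visits _ _ R S B (h n) x / 3 ^+ n.
have u0 n : 0 <= u n by rewrite divr_ge0 ?exprn_ge0 // sumr_ge0.
rewrite /lln_functional (_ : bit_freq _ = u) //.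
have p3 n : 0 < (3 ^- n : R) by rewrite invr_gt0 exprn_gt0.
apply: eq_ereal_rat => q qB.
  (* If [mu B < q], domination by [q] times the visits to the base bounds the functional by [q],
     against [qB]. *)
  rewrite leNgt; apply/negP => Bq; have [C xC] := xup q Bq.
  have q0 : 0 <= (ratr q : R).
    rewrite -lee_fin; apply: le_trans (ltW Bq); exact: measure_ge0.
  have : (limn_esup (EFin \o u) <= (ratr q * k)%:E)%E.
    apply: (limn_esup_le_affine q0 (C0 C) vk) => n.
    by rewrite /u /scaled_visits mulrA -mulrDl ler_pM2r // -[leLHS]mul1r.
  move=> uq; move: qB; apply/negP; rewrite -leNgt.
  apply: le_trans (lee_wpmul2l kV0 uq) _.
  by rewrite -EFinM lee_fin mulrC mulfK // gt_eqF.
(* Domination is available for nonnegative [q] only; a negative one lies below the functional by its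
   sign. *)
have [q0|q0] := leP 0 (ratr q : R); last first.
  by apply: le_trans (L0 (fun i => iter i S x \in B)); rewrite lee_fin ltW.
have [C xC] := xlow q q0 qB.
have uq : ((ratr q * k)%:E <= limn_esup (EFin \o u))%E.
  apply: (limn_esup_ge_affine q0 (C0 C) vk u0) => n.
  by rewrite /u /scaled_visits mulrA -mulrDl ler_pM2r // -[X in X + _]mul1r.
apply: le_trans (lee_wpmul2l kV0 uq).
by rewrite -EFinM lee_fin mulrC mulfK // gt_eqF.
Qed.

End chacon_lln.

Theorem proposition8p3 (R : realType) (P : chacon_params)
    (mu : {measure set (chaconX P) -> \bar R}) (hmu : chacon_measure mu) :
  rationally_ergodic mu (@chaconT P) /\ admits_measurable_lln mu (@chaconT P).
Proof.
split; first exact: rationally_ergodic_chaconT.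
exact: lln_chaconT.
Qed.
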